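(* Let $T$ be a tree on $n\geq 4$ vertices that is not a path, and let $M=(T)_{\mathrm{res}}$ be the matroid on ground set $V(T)$ whose independent sets are the subsets of minimal resolving sets of $T$. Then a subset $H\subseteq V(T)$ is a hyperplane of $M$ if and only if $H = V(T)\setminus (X_1\cup X_2)$, where $X_1, X_2$ are the vertex sets of two distinct legs at the same exterior major vertex of $T$.
   Context: For a connected graph $G$, $d(u,v)$ is the shortest-path distance. $R\subseteq V(G)$ is a resolving set if for any two distinct vertices $u,w$ there is $h\in R$ with $d(u,h)\neq d(w,h)$; it is minimal if no proper subset is resolving. For a tree $T$ and a vertex $v$ with $\deg(v)\ge 3$, a leg (branch path) at $v$ is a connected component of $T-v$ that is a path, exactly one of whose vertices is adjacent to $v$, that vertex being an endpoint of the path; $v$ is an exterior major vertex if $\deg(v)\ge 3$ and there is at least one leg at $v$. Known fact (Slater): a set $S$ is a minimal resolving set of a tree (not a path) iff for each exterior major vertex $v$, $S$ contains exactly one vertex from each of all but exactly one of the legs at $v$, and no other vertices. The rank $r(X)$ of $X\subseteq V(T)$ is the maximum size of an independent set contained in $X$; a flat is a set $F$ with $r(F)<r(F\cup\{x\})$ for all $x\notin F$; a hyperplane is a flat $H$ with $r(H)=r(V(T))-1$. *)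

(* Defs.v *)
From mathcomp Require Import all_boot.

Set Implicit Arguments.
Unset Strict Implicit.
Unset Printing Implicit Defensive.

(* A finite simple graph is a symmetric irreflexive relation [e] on a finType. *)
Section Graphs.
Variables (V : finType) (e : rel V).

Definition simple_graph : Prop := symmetric e /\ irreflexive e.

Definition connected_graph : Prop := forall x y : V, connect e x y.

(* The size bound discards the 2-cycles x, y, x along a single edge. *)
Definition acyclic_graph : Prop := forall c : seq V, 2 < size c -> ~ ucycle e c.

Definition is_tree : Prop :=
  [/\ simple_graph, connected_graph & acyclic_graph].

Definition degree (v : V) : nat := #|[set w | e v w]|.

Definition walk_of_length (x y : V) (k : nat) : bool :=
  [exists p : k.-tuple V, path e x p && (last x p == y)].

(* In a connected graph some walk from x to y has length < #|V|; when y is not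
   reachable from x the value is the junk #|V|. *)
Definition dist (x y : V) : nat := find (walk_of_length x y) (iota 0 #|V|).

Definition resolving (R : {set V}) : bool :=
  [forall u, forall w, (u != w) ==> [exists h in R, dist u h != dist w h]].

Definition minimal_resolving (R : {set V}) : bool := minset resolving R.

(* The subgraph induced on A is a path whose vertices, in order along the path,
   are x :: s; in particular its endpoints are x and last x s. *)
Definition path_ordering (A : {set V}) (x : V) (s : seq V) : Prop :=
  [/\ uniq (x :: s),
      A = [set z in x :: s]
    & {in A &, forall y z, e y z =
        ((index y (x :: s)).+1 == index z (x :: s))
        || ((index z (x :: s)).+1 == index y (x :: s))}].

Definition is_path (A : {set V}) : Prop :=
  exists x s, path_ordering A x s.

Definition path_endpoint (A : {set V}) (u : V) : Prop :=
  exists x s, path_ordering A x s /\ (u = x \/ u = last x s).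

Definition induced (A : {set V}) : rel V :=
  [rel x y | [&& x \in A, y \in A & e x y]].

(* C is (the vertex set of) a connected component of the subgraph induced on A. *)
Definition component (A C : {set V}) : Prop :=
  exists2 u, u \in A & C = [set w | connect (induced A) u w].

Definition leg (v : V) (C : {set V}) : Prop :=
  [/\ component [set~ v] C,
      is_path C
    & exists u, [set w in C | e v w] = [set u] /\ path_endpoint C u].

Definition exterior_major (v : V) : Prop :=
  3 <= degree v /\ exists C, leg v C.

End Graphs.

Section IndependenceSystems.
Variables (V : finType) (indep : pred {set V}).

Definition rank (X : {set V}) : nat :=
  \max_(I : {set V} | indep I && (I \subset X)) #|I|.

Definition flat (F : {set V}) : Prop :=
  forall x, x \notin F -> rank F < rank (x |: F).

(* rank H = rank V - 1, stated without truncated subtraction *)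
Definition hyperplane (H : {set V}) : Prop :=
  flat H /\ (rank H).+1 = rank [set: V].

End IndependenceSystems.

(* The independent sets of (T)_res. *)
Definition res_indep (V : finType) (e : rel V) : pred {set V} :=
  fun I => [exists S : {set V}, minimal_resolving e S && (I \subset S)].

(* Main.v *)
Require Import Defs.
From mathcomp Require Import all_boot zify.

(** A set is resolving iff it meets the union of every two distinct legs at a
    common vertex of degree at least 3: if [u] and [w] are not separated by [R],
    moving them towards an element of [R] yields two neighbours of one vertex
    [m] whose branches both avoid [R]; a branch avoiding [R] has no vertex of
    degree at least 3, since a farthest such vertex would carry two legs inside
    the branch; so both branches are legs at [m], a contradiction unless [m] has
    degree 2 and the tree is a path.

    The bases are thus the minimal sets hitting all pairs of sibling legs.  They
    miss exactly one leg around each centre, hence are equicardinal, and a set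
    has full rank iff it hits all pairs.  A hyperplane is then a maximal set
    missing some pair, i.e. the complement of the union of that pair: because
    legs are disjoint, such a complement misses no other pair. *)

Set Implicit Arguments.
Unset Strict Implicit.
Unset Printing Implicit Defensive.

(** * Minimal hitting sets for pairs of disjoint blocks with a common centre *)

Section PairHitting.

Variables (V I : finType) (C : eqType).
Variables (block : I -> {set V}) (centre : I -> C) (hits : pred {set V}).

Hypothesis block_neq0 : forall i, exists x, x \in block i.
Hypothesis block_inj : forall i j x, x \in block i -> x \in block j -> i = j.
Hypothesis hitsP : forall R,
  hits R <-> forall i j, i != j -> centre i = centre j ->
               exists2 x, x \in R & x \in block i :|: block j.

Let indep (J : {set V}) := [exists S : {set V}, minset hits S && (J \subset S)].

Lemma hitsPn R : ~~ hits R ->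
  exists i j, [/\ i != j, centre i = centre j
                & forall x, x \in block i :|: block j -> x \notin R].
Proof.
move=> nR.
case: (boolP [exists i, exists j, [&& i != j, centre i == centre j &
         [forall x, (x \in block i :|: block j) ==> (x \notin R)]]]) => [|nE].
  case/existsP=> i /existsP[j /and3P[ij /eqP cij /forallP h]].
  by exists i, j; split=> // x xij; move: (h x); rewrite xij.
case/negP: nR; apply/hitsP => i j ij cij.
move: nE; rewrite negb_exists => /forallP/(_ i).
rewrite negb_exists => /forallP/(_ j); rewrite ij cij eqxx /= negb_forall.
by case/existsP=> x; rewrite negb_imply negbK => /andP[xij xR]; exists x.
Qed.

Lemma hits_minset R : hits R -> exists2 S, minset hits S & S \subset R.
Proof. by move=> hR; have [S mS sS] := minset_exists hR; exists S. Qed.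

(** By minimality, deleting [x] leaves some sibling pair unhit, so [x] alone hits that pair. Blocks
    are disjoint, so [x] lies in just one of the two and [S] misses the other. *)
Lemma minset_hits_private S x : minset hits S -> x \in S ->
  exists i j, [/\ i != j, centre i = centre j, x \in block i,
    forall y, y \in S -> y \in block i -> y = x
    & forall y, y \in S -> y \notin block j].
Proof.
move=> mS xS.
have nh : ~~ hits (S :\ x).
  apply/negP => h; have /minsetP[_ mS'] := mS.
  by move: xS; rewrite -(mS' _ h (subsetDl _ _)) !inE eqxx.
have [i [j [ij cij h]]] := hitsPn nh.
have hS := minsetp mS; have [z zS zij] := (hitsP S).1 hS i j ij cij.
have zx : z = x by apply/eqP; have := h z zij; rewrite !inE zS andbT negbK.
wlog xi : i j ij cij h zij / x \in block i.
  move=> W; move: (zij); rewrite zx inE.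
  case/orP=> [xi|xj]; first exact: (W i j).
  apply: (W j i) => //; first by rewrite eq_sym.
  - by move=> y; rewrite setUC; exact: h.
  - by rewrite setUC.
have S1 y : y \in S -> y \in block i :|: block j -> y = x.
  by move=> yS yij; apply/eqP; have := h y yij; rewrite !inE yS andbT negbK.
exists i, j; split=> // y yS; first by move=> yi; apply: S1; rewrite // inE yi.
apply/negP=> yj; have yx : y = x by apply: S1; rewrite // inE yj orbT.
by rewrite yx in yj; rewrite (block_inj xi yj) eqxx in ij.
Qed.

Let met (S : {set V}) := [set i | [exists x in S, x \in block i]].

(** Every element of [S] lies in exactly one block and is the only element of [S] there. *)
Lemma card_minset_met S : minset hits S -> #|S| = #|met S|.
Proof.
move=> mS; pose f x := [pick i | x \in block i].
have fE x i : x \in block i -> f x = Some i.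
  move=> xi; rewrite /f; case: pickP => [j xj|/(_ i)]; last by rewrite xi.
  by rewrite (block_inj xi xj).
rewrite -(card_in_imset (f := f) (D := S)); last first.
  move=> x y xS yS; have [i [j [_ _ xi Si _]]] := minset_hits_private mS xS.
  have [i' [j' [_ _ yi' _ _]]] := minset_hits_private mS yS.
  rewrite (fE _ _ xi) (fE _ _ yi') => -[ii'].
  by apply/esym/Si; rewrite // ii'.
rewrite -(card_imset (met S) (f := @Some I)); last by move=> ? ? [].
apply: eq_card => o; apply/imsetP/imsetP => [[x xS ->]|[i]].
  have [i [j [_ _ xi _ _]]] := minset_hits_private mS xS.
  exists i; last exact: fE.
  by rewrite inE; apply/existsP; exists x; rewrite xS.
rewrite inE => /existsP[x /andP[xS xi]] ->; exists x => //.
by rewrite (fE _ _ xi).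
Qed.

(* A minimal hitting set misses exactly one block around each centre, so the
   missed blocks of any two of them are in bijection. *)
Lemma minset_hits_missed S i : minset hits S ->
  exists2 j, j \notin met S & centre j = centre i.
Proof.
move=> mS; case: (boolP (i \in met S)) => [|]; last by exists i.
rewrite inE => /existsP[x /andP[xS xi]].
have [i' [j [_ cij xi' _ h]]] := minset_hits_private mS xS.
exists j; last by rewrite -cij (block_inj xi xi').
rewrite inE; apply/existsP => -[y /andP[yS yj]].
by move: (h y yS); rewrite yj.
Qed.

Lemma hits_missed_inj S i j : hits S -> i \notin met S -> j \notin met S ->
  centre i = centre j -> i = j.
Proof.
move=> hS ni nj cij; apply/eqP/negPn/negP => ij.
have [x xS] := (hitsP S).1 hS i j ij cij.
rewrite inE => /orP[xi|xj]; [case/negP: ni|case/negP: nj];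
  by rewrite inE; apply/existsP; exists x; rewrite xS.
Qed.

(** Sending a block missed by [S] to a sibling missed by [S'] preserves centres, and is injective
    because [S] misses at most one block per centre. *)
Lemma leq_card_missed S S' : minset hits S -> minset hits S' ->
  #|~: met S| <= #|~: met S'|.
Proof.
move=> mS mS'.
(* Such a [j] always exists, by [minset_hits_missed], so the default [i] is never returned. *)
pose g i := odflt i [pick j | (j \notin met S') && (centre j == centre i)].
have gP i : (g i \notin met S') && (centre (g i) == centre i).
  rewrite /g; case: pickP => //= h.
  have [j nj cj] := minset_hits_missed i mS'.
  by move: (h j); rewrite nj cj eqxx.
rewrite -(card_in_imset (f := g) (D := ~: met S)).
  apply/subset_leq_card/subsetP => _ /imsetP[i _ ->].
  by rewrite inE; case/andP: (gP i).
move=> i j; rewrite !inE => ni nj gij.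
have [_ /eqP ci] := andP (gP i); have [_ /eqP cj] := andP (gP j).
apply: (hits_missed_inj (minsetp mS)); rewrite ?inE //.
by rewrite -ci -cj gij.
Qed.

Lemma minset_hits_card S S' : minset hits S -> minset hits S' -> #|S| = #|S'|.
Proof.
move=> mS mS'; rewrite !card_minset_met //.
have := leq_card_missed mS mS'; have := leq_card_missed mS' mS.
by have := cardsC (met S); have := cardsC (met S'); lia.
Qed.

Lemma indep_minset (S J : {set V}) : minset hits S -> J \subset S -> indep J.
Proof. by move=> mS sJ; apply/existsP; exists S; rewrite mS. Qed.

Lemma indep_card_le_rank (J X : {set V}) :
  indep J -> J \subset X -> #|J| <= rank indep X.
Proof.
move=> iJ sJ; apply: (leq_bigmax_cond (F := fun J : {set V} => #|J|)).
by rewrite iJ.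
Qed.

Lemma rank_attained S (X : {set V}) : minset hits S ->
  exists J, [/\ indep J, J \subset X & #|J| = rank indep X].
Proof.
move=> mS; rewrite /rank.
have [|J /andP[iJ sJ] ->] := @eq_bigmax_cond _
    [pred J : {set V} | indep J && (J \subset X)] (fun J : {set V} => #|J|).
  apply/card_gt0P; exists set0.
  by rewrite inE sub0set andbT (indep_minset mS) // sub0set.
by exists J.
Qed.

Lemma rank_le_minset S X : minset hits S -> rank indep X <= #|S|.
Proof.
move=> mS; apply/bigmax_leqP => J /andP[/existsP[S' /andP[mS' sJ]] _].
by rewrite (minset_hits_card mS mS'); exact: subset_leq_card.
Qed.

(** A hitting set contains a base. Conversely, an independent subset of [X] of full size equals the
    base extending it, so [X] contains a base. *)
Lemma hits_rankP S X : minset hits S -> hits X <-> rank indep X = #|S|.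
Proof.
move=> mS; split=> [/hits_minset[S' mS' sS']|rX].
  apply/eqP; rewrite eqn_leq rank_le_minset //= (minset_hits_card mS mS').
  exact: indep_card_le_rank (indep_minset mS' (subxx _)) sS'.
have [J [/existsP[S' /andP[mS' sJS']] sJX cJ]] := rank_attained X mS.
have JS' : J = S'.
  by apply/eqP; rewrite eqEcard sJS' cJ rX (minset_hits_card mS mS') leqnn.
apply/hitsP => i j ij cij.
have [x xS xij] := (hitsP S').1 (minsetp mS') i j ij cij.
by exists x => //; apply: (subsetP sJX); rewrite JS'.
Qed.

Lemma hitsT : hits setT.
Proof.
apply/hitsP => i j _ _; have [x xi] := block_neq0 i.
by exists x; rewrite ?inE ?xi.
Qed.

Lemma pair_hitting_hyperplane (H : {set V}) :
  hyperplane indep H <->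
  exists i j, [/\ i != j, centre i = centre j & H = ~: (block i :|: block j)].
Proof.
have [S mS _] := hits_minset hitsT.
have rT : rank indep setT = #|S| by apply/(hits_rankP setT mS)/hitsT.
have nhit i j : i != j -> centre i = centre j ->
    ~ hits (~: (block i :|: block j)).
  move=> ij cij /hitsP/(_ i j ij cij)[x]; rewrite in_setC => /negP nx.
  by move/nx.
split=> [[fH rH]|[i [j [ij cij ->]]]].
  have nH : ~~ hits H by apply/negP => /(hits_rankP H mS); lia.
  have [i [j [ij cij h]]] := hitsPn nH; exists i, j; split=> //.
  have sH : H \subset ~: (block i :|: block j).
    by apply/subsetP=> x xH; rewrite in_setC; apply: contraL xH; exact: h.
  apply/eqP; rewrite eqEsubset sH; apply/subsetP => x xK.
  (* By flatness, [x |: H] would have full rank and hit every pair, although it lies inside a set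
     missing the pair [i], [j]. *)
  case: (boolP (x \in H)) => // xH; exfalso; apply: (nhit i j ij cij).
  have rx : rank indep (x |: H) = #|S|.
    by have := fH x xH; have := rank_le_minset (x |: H) mS; lia.
  apply/hitsP => i' j' ij' cij'.
  have [y yH yij] := (hitsP _).1 ((hits_rankP _ mS).2 rx) i' j' ij' cij'.
  by exists y => //; move: yH; rewrite in_setU1 => /predU1P[->|/(subsetP sH)].
set K := ~: _.
have rK : rank indep K < #|S|.
  rewrite ltn_neqAle rank_le_minset // andbT; apply/eqP => rK.
  by apply: (nhit i j ij cij); apply/(hits_rankP _ mS).
have outK k : k != i -> k != j -> exists2 x, x \in K & x \in block k.
  move=> ki kj; have [x xk] := block_neq0 k; exists x => //.
  rewrite !inE; apply/norP; split; apply/negP => xij.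
    by rewrite (block_inj xk xij) eqxx in ki.
  by rewrite (block_inj xk xij) eqxx in kj.
(* The added vertex hits the pair [i], [j] itself; any other pair has a block distinct from both,
   which [K] meets. *)
have addK x : x \notin K -> hits (x |: K).
  rewrite in_setC negbK => xij; apply/hitsP => i' j' ij' cij'.
  have aux k : k \in [:: i'; j'] -> k != i -> k != j ->
      exists2 y, y \in x |: K & y \in block i' :|: block j'.
    move=> kij ki kj; have [y yK yk] := outK k ki kj.
    exists y; first by rewrite in_setU1 yK orbT.
    by move: kij; rewrite !inE => /orP[]/eqP <-; rewrite yk ?orbT.
  have [ei|ni] := eqVneq i' i.
    have [ej|nj] := eqVneq j' j; first by exists x; rewrite ?setU11 ?ei ?ej.
    by apply: (aux j'); rewrite ?inE ?eqxx ?orbT // -ei eq_sym.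
  have [ej|nj] := eqVneq i' j; last by apply: (aux i'); rewrite ?inE ?eqxx.
  have [ej'|nj'] := eqVneq j' i.
    by exists x; rewrite ?setU11 ?ej ?ej' // setUC.
  by apply: (aux j'); rewrite ?inE ?eqxx ?orbT // -ej eq_sym.
split=> [x xK|]; first by rewrite ((hits_rankP _ mS).1 (addK x xK)).
rewrite rT; apply/eqP; rewrite eqn_leq rK /=.
have [x xi] := block_neq0 i.
have xK : x \notin K by rewrite !inE xi.
(* A base inside [x |: K] loses at most [x] on restriction to [K], so the rank drops by only one. *)
have [S' mS' sS'] := hits_minset (addK x xK).
have sK : S' :\ x \subset K by rewrite subDset.
have := indep_card_le_rank (indep_minset mS' (subsetDl _ _)) sK.
by rewrite (minset_hits_card mS mS') (cardsD1 x S'); case: (x \in S'); lia.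
Qed.

End PairHitting.

(** * Shortest-path distance in a connected graph *)

Section Distance.

Variables (V : finType) (e : rel V).
Hypothesis adjC : symmetric e.
Hypothesis econn : connected_graph e.

Lemma dist_le_size x p : path e x p -> dist e x (last x p) <= size p.
Proof.
(* Lengths from [#|V|] on are outside the range searched, but there the bound holds because the
   search never returns more than [#|V|]. *)
move=> xp; rewrite /dist; case: (ltnP (size p) #|V|) => hp; last first.
  by apply: leq_trans (find_size _ _) _; rewrite size_iota.
rewrite leqNgt; apply/negP => /(before_find 0).
rewrite nth_iota // add0n => /negbT/negP[]; apply/existsP.
by exists (in_tuple p); rewrite xp eqxx.
Qed.

(** A connecting walk shortened to a duplicate-free one has length below [#|V|], so the search
    defining [dist] succeeds. *)
Lemma dist_geodesic x y :
  exists p, [/\ path e x p, last x p = y & size p = dist e x y].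
Proof.
have /connectP[p0 xp0 ->] := econn x y.
case: (shortenP xp0) => p xp up _.
have hp : size p < #|V|.
  by have := card_uniqP up; have := max_card (mem (x :: p)); rewrite /= => + <-.
have hs : has (walk_of_length e x (last x p)) (iota 0 #|V|).
  apply/hasP; exists (size p); first by rewrite mem_iota.
  by apply/existsP; exists (in_tuple p); rewrite xp eqxx.
have /existsP[q /andP[xq /eqP lq]] := nth_find 0 hs.
exists q; split=> //; rewrite size_tuple nth_iota //.
by rewrite has_find size_iota in hs.
Qed.

Lemma dist_triangle x y z : dist e x z <= dist e x y + dist e y z.
Proof.
have [p [xp lp <-]] := dist_geodesic x y.
have [q [yq <- <-]] := dist_geodesic y z.
rewrite -size_cat -lp -last_cat; apply: dist_le_size.
by rewrite cat_path xp lp.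
Qed.

Lemma dist_sym x y : dist e x y = dist e y x.
Proof.
suff le_dist u w : dist e u w <= dist e w u.
  by apply/eqP; rewrite eqn_leq !le_dist.
have [p [wp lp <-]] := dist_geodesic w u.
have <- : last u (rev (belast w p)) = w.
  by case: p {wp} lp => //= z p _; rewrite rev_cons last_rcons.
have <- : size (rev (belast w p)) = size p by rewrite size_rev size_belast.
apply: dist_le_size; rewrite -lp rev_path.
by rewrite (eq_path (e' := e)) // => a b /=; rewrite adjC.
Qed.

Lemma distxx x : dist e x x = 0.
Proof. by have := @dist_le_size x [::] isT; rewrite leqn0 => /eqP. Qed.

Lemma dist_eq0 x y : dist e x y = 0 -> x = y.
Proof.
move=> E; have [p [_ lp sp]] := dist_geodesic x y.
by move: lp; rewrite E in sp; case: p sp.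
Qed.

Lemma dist_adj x y : e x y -> dist e x y <= 1.
Proof. by move=> xy; apply: (@dist_le_size x [:: y]); rewrite /= xy. Qed.

Lemma dist_adj_le r x y : e x y -> dist e r x <= (dist e r y).+1.
Proof.
move=> xy; have := dist_triangle r y x.
by have := dist_adj xy; rewrite (dist_sym x y); lia.
Qed.

Lemma closer_neighbour r y : y != r ->
  exists2 x, e y x & dist e r y = (dist e r x).+1.
Proof.
move=> yr; have [[|x p] /= [+ lp sp]] := dist_geodesic y r.
  by rewrite lp eqxx in yr.
case/andP=> yx xp; exists x => //.
have := dist_le_size xp; rewrite lp (dist_sym x).
by have := dist_adj_le r yx; rewrite (dist_sym r y) -sp; lia.
Qed.

End Distance.

(** * Branches at a vertex of a tree, described by distances *)

Section Tree.

Variables (V : finType) (e : rel V).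
Hypothesis treeE : is_tree e.

Let adjC : symmetric e. Proof. by case: treeE => -[]. Qed.
Let eirr : irreflexive e. Proof. by case: treeE => -[]. Qed.
Let econn : connected_graph e. Proof. by case: treeE. Qed.

Notation d := (dist e).

Definition branch (v a : V) : {set V} :=
  [set w | connect (induced e [set~ v]) a w].

Lemma induced_sym A : symmetric (induced e A).
Proof. by move=> x y; rewrite /induced /= andbCA adjC. Qed.

Lemma connect_induced_sym A : connect_sym (induced e A).
Proof. by apply: sym_connect_sym; exact: induced_sym. Qed.

Lemma adj_neq x y : e x y -> x != y.
Proof. by apply: contraTneq => ->; rewrite eirr. Qed.

(** A path avoiding [v] between two distinct neighbours of [v] would close up to a cycle through
    [v]. *)
Lemma neighbour_inj v x y : e v x -> e v y ->
  connect (induced e [set~ v]) x y -> x = y.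
Proof.
move=> vx vy /connectP[p0 xp0 Ey]; case: (shortenP xp0) Ey => p xp up _ Ey.
case: p xp up Ey => [//|z p] xp up Ey; exfalso.
have avoid q u : path (induced e [set~ v]) u q -> v \notin q.
  elim: q u => //= w q IH u /andP[/and3P[_ + _] wq].
  by rewrite !inE negb_or eq_sym => -> /=; exact: IH wq.
have [_ _ acyc] := treeE; apply: (acyc (v :: x :: z :: p)) => //.
have xp' : path e x (z :: p) by apply: sub_path xp => a b /and3P[].
rewrite /ucycle; apply/andP; split.
  have lastE : last v [:: x, z & p] = y by rewrite Ey.
  by rewrite /cycle rcons_path lastE adjC vy andbT; apply/andP.
rewrite cons_uniq up andbT in_cons negb_or (adj_neq vx) /=.
exact: avoid xp.
Qed.

(* A geodesic from x to r has all its later vertices closer to r than y. *)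
Lemma connect_avoiding r x y : x != y -> d r x <= d r y ->
  connect (induced e [set~ y]) x r.
Proof.
have [k] := ubnP (d r x); elim: k x => // k IH x; rewrite ltnS => xk xy rxy.
have [-> //|xr] := eqVneq x r.
have [z xz rz] := closer_neighbour adjC econn xr.
have zy : z != y by apply: contraTneq rxy => <-; lia.
apply: connect_trans (connect1 _) (IH z _ zy _); try lia.
by rewrite /induced /= !inE xy zy.
Qed.

(** Both neighbours reach [r] while avoiding [y], so they lie in the same branch at [y]. *)
Lemma closer_neighbour_inj r y x x' : e y x -> e y x' ->
  d r x <= d r y -> d r x' <= d r y -> x = x'.
Proof.
move=> yx yx' rx rx'; apply: (neighbour_inj yx yx').
apply: (connect_trans (y := r)); last rewrite connect_induced_sym.
  by apply: connect_avoiding; rewrite // eq_sym adj_neq.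
by apply: connect_avoiding; rewrite // eq_sym adj_neq.
Qed.

(** From [x] one reaches, avoiding [v], the neighbour of [v] that is closer to [x]; it must be [a]
    when [x] is in the branch of [a]. *)
Lemma in_branch v a x : e v a -> (x \in branch v a) = (d x v == (d x a).+1).
Proof.
move=> va; rewrite inE; apply/idP/eqP => [ax|E]; last first.
  by apply: connect_avoiding; [rewrite eq_sym adj_neq | lia].
have xv : v != x.
  apply: contraTneq ax => <-; rewrite connect_induced_sym.
  apply/connectP => -[].
  case=> [_ /=|z p /= /andP[/and3P[]]].
    by move=> av; rewrite av eirr in va.
  by rewrite !inE eqxx.
have [b vb E] := closer_neighbour adjC econn xv.
suff -> : a = b by [].
apply: (neighbour_inj va vb); apply: (connect_trans ax).
rewrite connect_induced_sym; apply: connect_avoiding; last lia.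
by rewrite eq_sym adj_neq.
Qed.

(** The ends of an edge are never equidistant from [x]: otherwise [a] would coincide with a
    neighbour of [v] strictly closer to [x]. *)
Lemma notin_branch v a x : e v a ->
  (x \notin branch v a) = (d x a == (d x v).+1).
Proof.
move=> va; rewrite in_branch //.
have av : e a v by rewrite adjC.
have h1 := dist_adj_le adjC econn x va; have h2 := dist_adj_le adjC econn x av.
suff : d x v != d x a by lia.
apply/eqP => E.
have [xv|vx] := eqVneq v x.
  have xa : x = a by apply: (dist_eq0 econn); rewrite -E xv distxx.
  by rewrite xv xa eirr in va.
have [b vb Eb] := closer_neighbour adjC econn vx.
have : a = b by apply: (closer_neighbour_inj (r := x) va vb); lia.
by move=> ab; move: Eb; rewrite -ab; lia.
Qed.

Lemma branch_self v a : a \in branch v a.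
Proof. by rewrite inE connect0. Qed.

Lemma centre_notin_branch v a : e v a -> v \notin branch v a.
Proof. by move=> va; rewrite in_branch // distxx. Qed.

Lemma branch_adj v a x y : x \in branch v a -> e x y -> x != v -> y != v ->
  y \in branch v a.
Proof.
rewrite !inE => ax xy xv yv; apply: (connect_trans ax (connect1 _)).
by rewrite /induced /= !inE xv yv.
Qed.

Lemma branch_inj v a b x : e v a -> e v b ->
  x \in branch v a -> x \in branch v b -> a = b.
Proof.
rewrite !inE => va vb ax bx; apply: (neighbour_inj va vb).
by apply: (connect_trans ax); rewrite connect_induced_sym.
Qed.

Lemma in_branch_neq v a x : e v a -> x \in branch v a -> x != v.
Proof. by move=> va; apply: contraTneq => ->; exact: centre_notin_branch. Qed.

Lemma branch_cover v x : x != v -> exists2 a, e v a & x \in branch v a.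
Proof.
rewrite eq_sym => vx; have [a va E] := closer_neighbour adjC econn vx.
by exists a; rewrite // in_branch // E.
Qed.

(* Every walk leaving a branch at v goes through v. *)
Lemma dist_through v a h w : e v a -> h \in branch v a -> w \notin branch v a ->
  d h w = d h v + d v w.
Proof.
move=> va hB wB; apply/eqP; rewrite eqn_leq dist_triangle //=.
have [p [hp lp <-]] := dist_geodesic econn h w.
elim: p h hB hp lp => [|y p IH] h hB /=.
  by move=> _ hw; rewrite -hw hB in wB.
case/andP=> hy yp lp; have hv := in_branch_neq va hB.
have [yv|yv] := eqVneq y v.
  have := dist_le_size yp; rewrite lp yv; have := dist_adj hy; rewrite yv; lia.
have yB := branch_adj hB hy hv yv; have := IH y yB yp lp.
by have := dist_triangle econn h y v; have := dist_adj hy; lia.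
Qed.

(** * Thin branches, with degrees counted in the whole tree, and legs *)

Definition thin (A : {set V}) := [forall x in A, degree e x <= 2].

(* Take a vertex of degree at least 3 in A farthest from v: the branches at it
   which avoid v are thin. *)
Lemma exists_two_thin_branches v (A : {set V}) :
  (forall x c, x \in A -> e x c -> v \notin branch x c ->
     branch x c \subset A) ->
  ~~ thin A ->
  exists x c c', [/\ 3 <= degree e x, e x c /\ e x c', c != c',
    thin (branch x c) /\ thin (branch x c')
    & branch x c :|: branch x c' \subset A].
Proof.
move=> closedA; rewrite negb_forall => /existsP[x0]; rewrite negb_imply => x0A.
have [x /andP[xA degx] maxx] :=
  @arg_maxnP _ x0 (fun x => (x \in A) && ~~ (degree e x <= 2)) (d v) x0A.
rewrite -ltnNge in degx.
(* A vertex of degree at least 3 in this branch would be farther from [v] than [x], since its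
   geodesics to [v] pass through [x]. *)
have thinx c : e x c -> v \notin branch x c -> thin (branch x c).
  move=> xc vB; apply/forallP => w; apply/implyP => wB.
  have wA := subsetP (closedA _ _ xA xc vB) _ wB.
  case: (leqP (degree e w) 2) => // degw.
  have := maxx w; rewrite wA -ltnNge degw => /(_ isT).
  have := dist_through xc wB vB.
  rewrite (dist_sym adjC econn w v) (dist_sym adjC econn x v).
  have : d w x != 0.
    by apply: contra (in_branch_neq xc wB) => /eqP/(dist_eq0 econn) ->.
  lia.
have [c1 [c2 [c3 [[]]]]] := card_gt2P degx.
rewrite !inE => xc1 xc2 xc3 [n12 n23 n31].
have pair c c' : e x c -> e x c' -> c != c' ->
    v \notin branch x c -> v \notin branch x c' ->
  exists x c c', [/\ 3 <= degree e x, e x c /\ e x c', c != c',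
    thin (branch x c) /\ thin (branch x c')
    & branch x c :|: branch x c' \subset A].
  move=> xc xc' cc' vc vc'; exists x, c, c'; split=> //.
    by split; apply: thinx.
  by rewrite subUset !closedA.
have other c c' : e x c -> e x c' -> c != c' ->
    v \in branch x c -> v \notin branch x c'.
  move=> xc xc' cc' vc; apply: contra cc' => vc'.
  by apply/eqP; exact: branch_inj xc xc' vc vc'.
(* At most one of three branches at [x] contains [v]; two others remain. *)
case: (boolP (v \in branch x c1)) => v1.
  by apply: (pair c2 c3); rewrite ?(other c1) // eq_sym.
case: (boolP (v \in branch x c2)) => v2; last by apply: (pair c1 c2).
by apply: (pair c1 c3); rewrite ?(other c2) // eq_sym.
Qed.

(** Neither [v] nor [a] lies in [branch x c], so distances from its vertices to both split at [x],
    and [x] is closer to [a] than to [v]. *)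
Lemma branch_closed v a x c : e v a -> x \in branch v a -> e x c ->
  v \notin branch x c -> branch x c \subset branch v a.
Proof.
move=> va xB xc vB; apply/subsetP => w wB.
have xv := in_branch_neq va xB.
have aB : a \notin branch x c.
  apply: contra vB => aB; apply: (branch_adj aB); rewrite 1?eq_sym //.
    by rewrite adjC.
  by rewrite eq_sym; exact: in_branch_neq xc aB.
rewrite in_branch // (dist_through xc wB vB) (dist_through xc wB aB).
by move: xB; rewrite in_branch // => /eqP ->; rewrite addnS.
Qed.

(** The only neighbour of [v] in the branch is [a], so prepending [v] shifts every index by one and
    adds a single adjacency. *)
Lemma path_ordering_cons v a s : e v a -> path_ordering e (branch v a) a s ->
  path_ordering e (v |: branch v a) v (a :: s).
Proof.
move=> va [us Bs adj].
have memB z : (z \in branch v a) = (z \in a :: s) by rewrite Bs inE.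
have vB := centre_notin_branch va.
have adjv z : z \in branch v a -> e v z = (z == a).
  move=> zB; apply/idP/eqP => [vz|-> //].
  exact: branch_inj vz va (branch_self v z) zB.
have neqv z : z \in branch v a -> (v == z) = false.
  by move=> zB; apply: contraNF vB => /eqP {1}->.
have idx0 z : (0 == index z (a :: s)) = (z == a).
  by rewrite /= [z == a]eq_sym; case: (a == z).
split.
- by rewrite cons_uniq us andbT -memB.
- by apply/setP=> z; rewrite in_setU1 memB !inE.
move=> y z; rewrite !in_setU1.
have idx w : index w (v :: a :: s) =
    if v == w then 0 else (index w (a :: s)).+1 by [].
rewrite !idx => /predU1P[->|yB] /predU1P[->|zB]; rewrite ?eqxx ?eirr //.
- by rewrite neqv // adjv // eqSS idx0 orbF.
- by rewrite neqv // adjC adjv // eqSS idx0.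
by rewrite !neqv // !eqSS adj.
Qed.

Lemma branch_cons v a b : e v a -> e a b -> b != v -> degree e a <= 2 ->
  branch v a = a |: branch a b.
Proof.
move=> va ab bv da; have av : e a v by rewrite adjC.
have nv : v \notin branch a b.
  apply: contra bv => vB; apply/eqP.
  exact: branch_inj ab av vB (branch_self a v).
apply/setP=> x; rewrite in_setU1; have [->|xa] := eqVneq x a.
  by rewrite branch_self.
apply/idP/idP => [xB|]; last first.
  by apply: (subsetP (branch_closed va (branch_self v a) ab nv)).
(* Let [c] be the neighbour of [a] towards [x]. It is not [v], because [x] is closer to [a] than to
   [v]; if it were not [b], then [a] would have three neighbours. *)
have [c ac xc] := branch_cover xa; have [-> //|cb] := eqVneq b c.
have vc : v != c.
  apply: contraTneq xc => <-; rewrite in_branch // -?leqNgt.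
  by move: xB; rewrite in_branch // => /eqP ->; lia.
suff : 2 < degree e a by rewrite ltnNge da.
by apply/card_gt2P; exists b, c, v; split; split; rewrite ?inE // eq_sym.
Qed.

(** Induction on the size of the branch: either [a] has one further neighbour, whose smaller branch
    continues the path, or the branch is just [a]. *)
Lemma thin_path_ordering v a : e v a -> thin (branch v a) ->
  exists s, path_ordering e (branch v a) a s.
Proof.
have [k] := ubnP #|branch v a|; elim: k v a => // k IH v a.
rewrite ltnS => Bk va /forallP th.
have da : degree e a <= 2 by have := th a; rewrite branch_self.
case: (pickP [pred b | e a b && (b != v)]) => [b /andP[ab bv]|nob].
  have Bcons := branch_cons va ab bv da.
  have [||s os] := IH a b _ ab; last first.
  - by exists (b :: s); rewrite Bcons; exact: path_ordering_cons.
  - apply/forallP => x; have := th x; rewrite Bcons in_setU1.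
    by case: (x \in branch a b); rewrite ?orbT.
  - by move: Bk; rewrite Bcons cardsU1 centre_notin_branch.
have B1 : branch v a = [set a].
  apply/setP=> x; rewrite in_set1; have [->|xa] := eqVneq x a.
    by rewrite branch_self.
  apply/negP => xB; have [c ac xc] := branch_cover xa.
  have := nob c; rewrite /= ac /= => /negbFE/eqP cv.
  have av : e a v by rewrite adjC.
  by move: xc xB; rewrite cv (in_branch _ va) (in_branch _ av); lia.
exists [::]; split=> //; rewrite B1; first by apply/setP=> x; rewrite !inE.
by move=> y z /set1P -> /set1P ->; rewrite eirr /= eqxx.
Qed.

(** A vertex [l] farthest from [r] is a leaf, since none of its neighbours is farther from [r]; the
    rest of the tree is a single thin branch at [l]. *)
Lemma thin_tree_path : 1 < #|V| -> thin setT -> is_path e setT.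
Proof.
move=> /card_gt1P[r [r' [_ _ rr']]] /forallP thT.
have [l _ maxl] := @arg_maxnP _ r xpredT (d r) isT.
have lr : l != r.
  apply: contraTneq (maxl r' isT) => ->; rewrite -ltnNge distxx lt0n.
  by apply: contra rr' => /eqP/(dist_eq0 econn) ->.
have [a la E] := closer_neighbour adjC econn lr.
have Bl : setT = l |: branch l a.
  apply/setP=> x; rewrite in_setU1 inE; have [//|xl] := eqVneq x l.
  have [b lb xb] := branch_cover xl.
  suff -> : a = b by [].
  by apply: (closer_neighbour_inj (r := r) la lb); [lia | exact: maxl].
have [|s os] := thin_path_ordering la; last first.
  by exists l, (a :: s); rewrite Bl; exact: path_ordering_cons.
by apply/forallP => x; have := thT x; rewrite inE /= => ->; rewrite implybT.
Qed.

(* In a path ordering of a leg, a third neighbour would have to sit at one of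
   the two positions next to x. *)
Lemma legP v X : leg e v X <-> exists a, [/\ e v a, X = branch v a & thin X].
Proof.
split=> [[[u0 u0v XE] _ [u [Xu uend]]]|[a [va -> th]]]; last first.
  have [s os] := thin_path_ordering va th.
  split; [|by exists a, s|].
    by exists a => //; rewrite !inE eq_sym adj_neq.
  exists a; split; last by exists a, s; split; [|left].
  apply/setP=> w; rewrite !inE -/(w \in branch v a).
  apply/andP/eqP => [[wB vw]|->]; last by rewrite connect0.
  by apply: (branch_inj vw va (branch_self v w)); rewrite inE.
have /setIdP[uX vu] : u \in [set w in X | e v w] by rewrite Xu set11.
have XB : X = branch v u.
  apply/setP=> w; move: uX; rewrite XE !inE => u0u.
  by apply: same_connect u0u w; exact: connect_induced_sym.
exists u; split=> //; apply/forallP => x; apply/implyP => xX.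
rewrite leqNgt; apply/negP => /card_gt2P[y1 [y2 [y3 [[+ + +] [n12 n23 n31]]]]].
rewrite !inE => xy1 xy2 xy3.
have xv : x != v by apply: (in_branch_neq vu); rewrite -XB.
have nbX y : e x y -> y != v -> y \in X.
  by move=> xy yv; rewrite XB; apply: (branch_adj _ xy xv yv); rewrite -XB.
have xu : e x v -> x = u.
  by move=> xv'; apply/set1P; rewrite -Xu inE xX adjC.
case: uend => b [s [[us Xs adj] ub]].
have memX y : y \in X -> y \in b :: s by rewrite Xs inE.
have idx y z : y \in X -> z \in X -> y != z ->
    index y (b :: s) <> index z (b :: s).
  move=> yX zX yz E; case/eqP: yz.
  by rewrite -(nth_index b (memX _ yX)) E nth_index // memX.
have szX y : y \in X -> index y (b :: s) < (size s).+1.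
  by move=> yX; rewrite -[(size s).+1]/(size (b :: s)) index_mem memX.
have uidx : index u (b :: s) = 0 \/ index u (b :: s) = size s.
  case: ub => ->; first by left; rewrite /= eqxx.
  by right; rewrite (last_nth b) index_uniq.
have adjX y : e x y -> y != v ->
    (index x (b :: s)).+1 = index y (b :: s)
    \/ (index y (b :: s)).+1 = index x (b :: s).
  move=> xy yv; have := adj x y xX (nbX y xy yv).
  by rewrite xy => /esym/orP[]/eqP; auto.
(* A leg vertex adjacent to [v] is the endpoint [u], which has at most one neighbour along the
   path. *)
have two y z : e x y -> e x z -> y != z -> y != v -> z != v -> e x v -> False.
  move=> xy xz yz yv zv /xu xu'.
  have := adjX y xy yv; have := adjX z xz zv.
  have := idx _ _ (nbX y xy yv) (nbX z xz zv) yz.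
  have := szX _ (nbX y xy yv); have := szX _ (nbX z xz zv).
  rewrite xu'; move: uidx; move: (index u _) (index y _) (index z _) (size s).
  by clear; lia.
have [E1|v1] := eqVneq y1 v.
  by apply: (two y2 y3); rewrite // -E1 // eq_sym.
have [E2|v2] := eqVneq y2 v.
  by apply: (two y1 y3); rewrite // -?E2 // eq_sym.
have [E3|v3] := eqVneq y3 v.
  by apply: (two y1 y2); rewrite // -E3.
have := adjX _ xy1 v1; have := adjX _ xy2 v2; have := adjX _ xy3 v3.
have := idx _ _ (nbX _ xy1 v1) (nbX _ xy2 v2) n12.
have := idx _ _ (nbX _ xy2 v2) (nbX _ xy3 v3) n23.
have := idx _ _ (nbX _ xy3 v3) (nbX _ xy1 v1) n31.
move: (index x _) (index y1 _) (index y2 _) (index y3 _).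
by clear; lia.
Qed.

(* Otherwise both centres lie outside the other's branch, and each would lie
   between x and the other. *)
Lemma thin_branch_inj v a v' a' x : e v a -> e v' a' ->
  2 < degree e v -> 2 < degree e v' ->
  thin (branch v a) -> thin (branch v' a') ->
  x \in branch v a -> x \in branch v' a' -> v = v' /\ a = a'.
Proof.
move=> va va' dv dv' th th' xB xB'.
have out w b : 2 < degree e w -> thin b -> w \notin b.
  by move=> dw /forallP/(_ w); apply: contraL => wb; rewrite wb /= -ltnNge.
have vv' : v = v'.
  apply: (dist_eq0 econn).
  (* The distances from [x] to [v] and to [v'] each exceed the other by [d v v'], which is therefore
     0. *)
  have := dist_through va xB (out _ _ dv' th).
  have := dist_through va' xB' (out _ _ dv th').
  rewrite (dist_sym adjC econn v' v); lia.
by split=> //; subst v'; exact: branch_inj va va' xB xB'.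
Qed.

(** * Resolving sets as sets hitting pairs of sibling legs *)

Lemma resolving_hits_branches v a b (R : {set V}) : e v a -> e v b -> a != b ->
  resolving e R -> exists2 x, x \in R & x \in branch v a :|: branch v b.
Proof.
move=> va vb ab /forallP/(_ a)/forallP/(_ b); rewrite ab /=.
case/existsP=> h /andP[hR dh]; exists h => //.
(* From outside both branches, [a] and [b] are each one step beyond [v]. *)
apply: contraR dh; rewrite inE negb_or !notin_branch //.
case/andP=> /eqP ha /eqP hb.
by rewrite (dist_sym adjC econn a) (dist_sym adjC econn b) ha hb.
Qed.

(* Moving two unresolved vertices towards a landmark h0 keeps them unresolved
   until they become two neighbours of a common vertex m. *)
Lemma unresolved_branches (R : {set V}) h0 u w : h0 \in R -> u != w ->
  (forall h, h \in R -> d h u = d h w) ->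
  exists m a b, [/\ e m a, e m b, a != b
    & forall h, h \in R -> h \notin branch m a :|: branch m b].
Proof.
move=> h0R; have [k] := ubnP (d h0 u); elim: k u w => // k IH u w.
rewrite ltnS => uk uw Ruw.
have D0 := Ruw _ h0R.
have uh : u != h0.
  apply: contra uw => /eqP uh; rewrite uh distxx in D0.
  by rewrite uh (dist_eq0 econn (esym D0)).
have wh : w != h0.
  apply: contra uw => /eqP wh; rewrite wh distxx in D0.
  by rewrite wh (dist_eq0 econn D0).
have [u' uu' Eu] := closer_neighbour adjC econn uh.
have [w' ww' Ew] := closer_neighbour adjC econn wh.
have u'u : e u' u by rewrite adjC.
have w'w : e w' w by rewrite adjC.
(* If the two vertices meet, that common vertex is [m]: a landmark in one branch, hence not in the
   other, would be closer to one of [u], [w] than to the other. *)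
have [E|u'w'] := eqVneq u' w'.
  have u'w : e u' w by rewrite E.
  exists u', u, w; split=> // h hR.
  have Dh := Ruw h hR.
  apply/negP; rewrite inE => /orP[hB|hB].
    have : h \notin branch u' w.
      by apply: contra uw => hB'; apply/eqP; exact: branch_inj u'u u'w hB hB'.
    by move: hB; rewrite in_branch // notin_branch //; clear -Dh; lia.
  have : h \notin branch u' u.
    by apply: contra uw => hB'; apply/eqP; exact: branch_inj u'u u'w hB' hB.
  by move: hB; rewrite in_branch // notin_branch //; clear -Dh; lia.
(* Here [y] is outside [branch x' x]: otherwise it would be adjacent to [x'], forcing [x' = y']. A
   landmark inside would then be strictly closer to [x] than to [y]. *)
have key x x' y y' h : h \in R -> e x x' -> e y y' -> x' != y' ->
    d h0 x = (d h0 x').+1 -> d h0 y = (d h0 y').+1 -> d h0 x = d h0 y ->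
    d h x = d h y -> h \notin branch x' x.
  move=> hR xx' yy' x'y' Ex Ey E0 Eh; have x'x : e x' x by rewrite adjC.
  have h0B : h0 \notin branch x' x by rewrite notin_branch // Ex.
  have yB : y \notin branch x' x.
    apply/negP => yB; have := dist_through x'x yB h0B.
    rewrite (dist_sym adjC econn y) (dist_sym adjC econn x' h0) => D.
    have D1 : d y x' = 1 by clear -D E0 Ex; lia.
    have yx' : e y x'.
      have [p [yp lp sp]] := dist_geodesic econn y x'; rewrite D1 in sp.
      by case: p yp lp sp => [|z [|]] //= /andP[yz _] <-.
    by case/eqP: x'y'; apply: (closer_neighbour_inj (r := h0) yx' yy');
      clear -Ex Ey E0; lia.
  apply/negP => hB; have := dist_through x'x hB yB.
  by move: hB; rewrite in_branch // => /eqP; clear -Eh; lia.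
apply: (IH u' w') => //; first by clear -uk Eu; lia.
move=> h hR; have Dh := Ruw h hR.
have := key u u' w w' h hR uu' ww' u'w' Eu Ew D0 Dh.
rewrite eq_sym in u'w'.
have := key w w' u u' h hR ww' uu' u'w' Ew Eu (esym D0) (esym Dh).
by rewrite !notin_branch //; clear -Dh; lia.
Qed.

(** A leg is encoded by its centre and its vertex of contact, giving a finite index type for the
    abstract blocks. *)
Definition leg_index := {p : V * V |
  [&& e p.1 p.2, 2 < degree e p.1 & thin (branch p.1 p.2)]}.

Definition leg_set (i : leg_index) : {set V} := branch (val i).1 (val i).2.
Definition leg_centre (i : leg_index) : V := (val i).1.

Lemma leg_index_exists v a : e v a -> 2 < degree e v -> thin (branch v a) ->
  exists i : leg_index, val i = (v, a).
Proof.
move=> va dv th.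
have P : [&& e (v, a).1 (v, a).2, 2 < degree e (v, a).1
           & thin (branch (v, a).1 (v, a).2)] by rewrite /= va dv.
by exists (exist _ (v, a) P).
Qed.

Lemma leg_set_inj i j x : x \in leg_set i -> x \in leg_set j -> i = j.
Proof.
case: i j => [[v a] /= Pi] [[v' a'] /= Pj]; rewrite /leg_set /= => xi xj.
have /and3P[/= va dv th] := Pi; have /and3P[/= va' dv' th'] := Pj.
have [Ev Ea] := thin_branch_inj va va' dv dv' th th' xi xj.
by apply: val_inj; rewrite /= Ev Ea.
Qed.

Lemma resolving_hitsP (R : {set V}) : 1 < #|V| -> ~ is_path e [set: V] ->
  resolving e R <-> forall i j, i != j -> leg_centre i = leg_centre j ->
    exists2 x, x \in R & x \in leg_set i :|: leg_set j.
Proof.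
move=> V1 npath; split=> [resR [[v a] Pi] [[v' b] Pj]|hitR].
  have /and3P[/= va _ _] := Pi; have /and3P[/= vb _ _] := Pj.
  rewrite /leg_centre /= -val_eqE /= => ij vv'; subst v'.
  apply: resolving_hits_branches => //.
  by apply: contraNneq ij => /= ->.
have hit x c c' : 2 < degree e x -> e x c -> e x c' -> c != c' ->
    thin (branch x c) -> thin (branch x c') ->
    exists2 y, y \in R & y \in branch x c :|: branch x c'.
  move=> dx xc xc' cc' th th'.
  have [i Ei] := leg_index_exists xc dx th.
  have [j Ej] := leg_index_exists xc' dx th'.
  have := hitR i j; rewrite -val_eqE /leg_centre /leg_set Ei Ej xpair_eqE eqxx.
  exact.
have nthT : ~~ thin setT by apply/negP => /(thin_tree_path V1).
(* A tree that is not a path has a pair of sibling legs, so [R] contains some landmark [h0]. *)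
have [r _] : exists r : V, r \in V by apply/card_gt0P; exact: ltnW.
have [|x [c [c' [dx [xc xc'] cc' [th th'] _]]]] :=
  @exists_two_thin_branches r setT _ nthT; first by move=> *; exact: subsetT.
have [h0 h0R _] := hit x c c' dx xc xc' cc' th th'.
apply/forallP => u; apply/forallP => w; apply/implyP => uw.
apply: contraT => /existsPn unres.
have Ruw h : h \in R -> d h u = d h w.
  move=> hR; have := unres h; rewrite hR /= negbK => /eqP.
  by rewrite !(dist_sym adjC econn _ h).
have [m [a [b [ma mb ab miss]]]] := unresolved_branches h0R uw Ruw.
(* A branch that is not thin contains two sibling legs, hence an element of [R]. *)
have thinm t : e m t -> (forall h, h \in R -> h \notin branch m t) ->
    thin (branch m t).
  move=> mt misst; apply: contraT => nth.
  have [|y [f [f' [dy [yf yf'] ff' [thf thf'] sub]]]] :=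
    @exists_two_thin_branches m (branch m t) _ nth.
    by move=> z g zB zg mB; exact: branch_closed.
  have [h hR hB] := hit y f f' dy yf yf' ff' thf thf'.
  by have := misst h hR; rewrite (subsetP sub).
have tha : thin (branch m a).
  by apply: thinm => // h hR; have := miss h hR; rewrite inE => /norP[].
have thb : thin (branch m b).
  by apply: thinm => // h hR; have := miss h hR; rewrite inE => /norP[].
have [dm|dm] := ltnP 2 (degree e m).
  have [h hR hB] := hit m a b dm ma mb ab tha thb.
  by have := miss h hR; rewrite hB.
(* With degree at most 2, [m] has only the neighbours [a] and [b], both with thin branches, so the
   whole tree would be thin. *)
case/negP: nthT; apply/forallP => z; apply/implyP => _.
have [-> //|zm] := eqVneq z m.
have [g mg zB] := branch_cover zm.
have [ga|ga] := eqVneq g a.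
  by move/forallP: tha => /(_ z); rewrite -ga zB.
have [gb|gb] := eqVneq g b.
  by move/forallP: thb => /(_ z); rewrite -gb zB.
suff : 2 < degree e m by rewrite ltnNge dm.
by apply/card_gt2P; exists a, b, g; split; split; rewrite ?inE // eq_sym.
Qed.

End Tree.

Theorem theorem3 (V : finType) (e : rel V) (hT : is_tree e) (hn : 4 <= #|V|)
    (hnp : ~ is_path e [set: V]) (H : {set V}) :
  hyperplane (res_indep e) H <->
  exists (v : V) (X1 X2 : {set V}),
    [/\ exterior_major e v, leg e v X1, leg e v X2, X1 <> X2
      & H = [set: V] :\: (X1 :|: X2)].
Proof.
have V1 : 1 < #|V| by lia.
have leg_neq0 i : exists x, x \in @leg_set V e i.
  by exists (val i).2; exact: branch_self.
(* With [resolving e] as [hits], the abstract independence system unfolds to [res_indep e]; what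
   remains is to translate leg indices into legs. *)
apply: (iff_trans (pair_hitting_hyperplane leg_neq0 (leg_set_inj hT)
  (fun R => resolving_hitsP hT R V1 hnp) H)).
split=> [[i [j [ij cij ->]]]|[v [X1 [X2 [[dv _] /(legP hT)[a [va -> tha]]
    /(legP hT)[b [vb -> thb]] ab ->]]]]].
  have /and3P[vi di thi] := valP i; have /and3P[vj dj thj] := valP j.
  have legi : leg e (leg_centre i) (leg_set i).
    by apply/(legP hT); exists (val i).2.
  exists (leg_centre i), (leg_set i), (leg_set j); split=> //.
  - by split; last exists (leg_set i).
  - by rewrite cij; apply/(legP hT); exists (val j).2.
  - move=> E; have [x xi] := leg_neq0 i; move: (xi); rewrite E => xj.
    by rewrite (leg_set_inj hT xi xj) eqxx in ij.
  - by rewrite setTD.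
have [i Ei] := leg_index_exists va dv tha.
have [j Ej] := leg_index_exists vb dv thb.
exists i, j; rewrite -val_eqE /leg_centre /leg_set Ei Ej setTD; split=> //.
by rewrite xpair_eqE eqxx /=; apply/eqP => E; case: ab; rewrite E.
Qed.
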